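(* Let $p=p(n)\in(0,1/2]$ be a function on the natural numbers such that $\frac{np}{\log n}\to\infty$ as $n\to\infty$. Let $\chi$ be a random $(p,1-p)$-colouring of the hypercube $Q_n$. Then with high probability, $\chi$ is $3$-distinguishable.
   Context: $Q_n$ is the $n$-dimensional hypercube: vertex set $\{0,1\}^n$, two vertices adjacent iff they differ in exactly one coordinate. A random $(p,1-p)$-colouring of $Q_n$ is an independent family $(\chi(v))_{v\in V(Q_n)}$ of random variables with $\mathbb{P}[\chi(v)=0]=p$ and $\mathbb{P}[\chi(v)=1]=1-p$. ''With high probability'' means with probability tending to $1$ as $n\to\infty$. For a vertex $v$, $B_r(v)$ is the subgraph induced by the vertices at graph distance at most $r$ from $v$, and $\chi^{(r)}(v)=\chi|_{B_r(v)}$. Colourings $\chi$ of a graph $G$ and $\lambda$ of a graph $H$ are equivalent, $\chi\cong\lambda$, if there is a graph isomorphism $\phi:G\to H$ with $\chi=\lambda\circ\phi$. Colourings $\chi,\lambda$ of $V(Q_n)$ are $r$-locally equivalent, $\chi\cong_r\lambda$, if there is a bijection $f:V(Q_n)\to V(Q_n)$ with $\chi^{(r)}(v)\cong\lambda^{(r)}(f(v))$ for all $v$. A colouring $\chi$ is $r$-distinguishable if there is no colouring $\lambda$ of $V(Q_n)$ with $\chi\cong_r\lambda$ but $\chi\not\cong\lambda$. *)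

(* Defs.v *)
From HB Require Import structures.
From mathcomp Require Import all_boot all_order all_algebra.
From mathcomp Require Import all_classical all_reals all_analysis.

Set Implicit Arguments.
Unset Strict Implicit.
Unset Printing Implicit Defensive.

Import Order.TTheory GRing.Theory Num.Theory.
Import numFieldNormedType.Exports.

Local Open Scope classical_set_scope.
Local Open Scope ring_scope.

(* A graph is given by a vertex type and an adjacency relation on it. *)

Definition graph_iso (V W : Type) (eV : rel V) (eW : rel W) (phi : V -> W) :
    Prop :=
  bijective phi /\ forall x y, eW (phi x) (phi y) = eV x y.

Definition col_equiv (C V W : Type) (eV : rel V) (eW : rel W)
    (chi : V -> C) (lam : W -> C) : Prop :=
  exists phi : V -> W, graph_iso eV eW phi /\ forall x, chi x = lam (phi x).

(* [path e v s] says that v :: s is a walk, which has [size s] edges. *)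
Definition dist_le (V : finType) (e : rel V) (r : nat) (v u : V) : bool :=
  [exists s : r.-bseq V, path e v s && (last v s == u)].

Definition gball (V : finType) (e : rel V) (r : nat) (v : V) : Type :=
  {u : V | dist_le e r v u}.

Definition gball_rel (V : finType) (e : rel V) (r : nat) (v : V) :
    rel (gball e r v) :=
  fun x y => e (val x) (val y).

Definition local_col (C : Type) (V : finType) (e : rel V) (r : nat)
    (chi : V -> C) (v : V) : gball e r v -> C :=
  fun x => chi (val x).

Definition locally_equiv (C : Type) (V : finType) (e : rel V) (r : nat)
    (chi lam : V -> C) : Prop :=
  exists f : V -> V, bijective f /\
    forall v, col_equiv (@gball_rel V e r v) (@gball_rel V e r (f v))
                (@local_col C V e r chi v) (@local_col C V e r lam (f v)).

Definition distinguishable (C : Type) (V : finType) (e : rel V) (r : nat)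
    (chi : V -> C) : Prop :=
  ~ exists lam : V -> C, locally_equiv e r chi lam /\ ~ col_equiv e e chi lam.

Definition cube (n : nat) : finType := {ffun 'I_n -> bool}.

Definition cube_rel (n : nat) : rel (cube n) :=
  fun x y => #|[pred i | x i != y i]| == 1%N.

Definition independent_family (R : realType) (d d' : measure_display)
    (T : measurableType d) (T' : measurableType d') (P : probability T R)
    (I : finType) (X : I -> T -> T') : Prop :=
  forall (J : {set I}) (B : I -> set T'), (forall i, measurable (B i)) ->
    P (\bigcap_(i in [set` J]) (X i @^-1` B i)) =
    (\prod_(i in J) P (X i @^-1` B i))%E.

(* Colour 0 is [false] and colour 1 is [true]. *)
Definition random_colouring (R : realType) (d : measure_display)
    (T : measurableType d) (P : probability T R) (n : nat) (p : R)
    (chi : cube n -> {RV P >-> bool}) : Prop :=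
  [/\ independent_family P (fun v => chi v : T -> bool),
      forall v, P (chi v @^-1` [set false]) = p%:E &
      forall v, P (chi v @^-1` [set true]) = (1 - p)%:E].

(* Main.v *)
Require Import Defs.
From HB Require Import structures.
From mathcomp Require Import all_boot all_order all_algebra.
From mathcomp Require Import all_classical all_reals all_analysis.
From mathcomp Require Import zify lra.

(** An isomorphism between 3-balls of the cube fixes the centres, and restricts to
    isomorphisms of the 2-balls around the neighbours of the centre. Hence, if no
    two 2-balls of [chi] are isomorphic, a bijection [f] matching the 3-balls of
    [chi] with those of [lam] must send neighbours to neighbours, so that it is an
    automorphism carrying [chi] to [lam].

    An isomorphism from the 2-ball at [v] to that at [w] is determined by a
    permutation [s] of the coordinates. At least [C(n - 4, 2)] of the vertices at
    distance 2 from [v] have distance more than 2 from [w], so [chi] is compatible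
    with [s] with probability at most [(p^2 + (1 - p)^2) ^ C(n - 4, 2)]. The union
    bound over the at most [(4 n)^n] triples [(v, w, s)] tends to 0 as soon as
    [n p >= 24 log n] eventually. *)

Set Implicit Arguments.
Unset Strict Implicit.
Unset Printing Implicit Defensive.

Import Order.TTheory GRing.Theory Num.Theory.
Import numFieldNormedType.Exports.

Local Open Scope classical_set_scope.
Local Open Scope ring_scope.

(** * Walks and balls in a finite graph *)

Section Walks.
Variables (V : finType) (e : rel V).

Lemma dist_leP r v u :
  reflect (exists s, [/\ (size s <= r)%N, path e v s & last v s = u])
          (dist_le e r v u).
Proof.
apply: (iffP existsP) => [[s /andP[es /eqP <-]]|[s [rs es <-]]].
  by exists s; split => //; exact: size_bseq.
by exists (Bseq rs); rewrite es /=.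
Qed.

Lemma dist_le_refl r v : dist_le e r v v.
Proof. by apply/dist_leP; exists [::]. Qed.

Lemma dist_le_mem r v s y :
  (size s <= r)%N -> path e v s -> y \in s -> dist_le e r v y.
Proof.
move=> rs es ys; case/splitPr: ys rs es => s1 s2.
rewrite size_cat /= cat_path /= => rs /and3P[es1 ey _].
apply/dist_leP; exists (rcons s1 y); rewrite size_rcons rcons_path es1 ey last_rcons.
by split=> //; lia.
Qed.

(** A walk of length at most [r] from [v] stays in the ball, so preserving edges there is enough for
    [F] to carry the whole walk. *)
Lemma dist_le_homo r v (F : V -> V) :
    {in dist_le e r v &, {homo F : x y / e x y}} ->
  forall x, dist_le e r v x -> dist_le e r (F v) (F x).
Proof.
move=> Fe x /dist_leP[s [rs es <-]]; apply/dist_leP; exists (map F s).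
rewrite size_map last_map; split => //.
apply: (homo_path_in Fe) => //=; rewrite dist_le_refl /=.
by apply/allP => y; exact: dist_le_mem.
Qed.

(** Trades an isomorphism between subtypes for a total map on [V], with all its properties
    relativised to the balls. *)
Lemma col_equiv_ball (C : Type) r v w (c l : V -> C) :
    col_equiv (@gball_rel V e r v) (@gball_rel V e r w)
      (@local_col C V e r c v) (@local_col C V e r l w) ->
  exists F : V -> V,
    [/\ {in dist_le e r v &, injective F},
        {in dist_le e r v &, {mono F : x y / e x y}},
        forall y, dist_le e r w y -> exists2 x, dist_le e r v x & F x = y,
        {in dist_le e r v, forall x, dist_le e r w (F x)} &
        {in dist_le e r v, forall x, c x = l (F x)}].
Proof.
move=> [phi [[[psi phiK psiK] phie] phic]].
(* Outside the ball the value [x] is an arbitrary default. *)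
pose F x := if insub x is Some y then val (phi y) else x.
have FE x (xv : dist_le e r v x) : F x = val (phi (exist _ x xv)).
  by rewrite /F; rewrite insubT.
exists F; split.
- move=> x y xv yv; rewrite !FE => /val_inj/(can_inj phiK).
  by move=> /(congr1 val).
- by move=> x y xv yv; rewrite !FE; exact: (phie (exist _ x xv) (exist _ y yv)).
- move=> y yw; case E : (psi (exist _ y yw)) => [x xv]; exists x => //.
  by rewrite FE -E psiK.
- by move=> x xv; rewrite FE; exact: valP.
- by move=> x xv; rewrite FE; exact: (phic (exist _ x xv)).
Qed.

End Walks.

(** * Coordinate flips, distances in the cube and matching of layers *)

Section Flips.
Import mathcomp.boot.fintype mathcomp.boot.finset.
Variable n : nat.
Implicit Types (x y v w : cube n) (A B : {set 'I_n}).

(** Translation by the indicator of [A] modulo 2. Seen from a base point [x], vertices become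
    coordinate sets and distance becomes cardinality, [diff_set x] being the inverse coding. *)
Definition flip x A : cube n := [ffun k => x k (+) (k \in A)].

Definition diff_set x y : {set 'I_n} := [set k | x k != y k].

Lemma flip_inj x : injective (flip x).
Proof.
move=> A B /ffunP AB; apply/setP => k; have := AB k.
by rewrite !ffunE => /addbI.
Qed.

Lemma flip_set0 x : flip x set0 = x.
Proof. by apply/ffunP => k; rewrite ffunE inE addbF. Qed.

Lemma flip_diff x y : flip x (diff_set x y) = y.
Proof. by apply/ffunP => k; rewrite ffunE inE; case: (x k) (y k) => [] []. Qed.

Lemma diff_flip x A : diff_set x (flip x A) = A.
Proof. by apply: (@flip_inj x); rewrite flip_diff. Qed.

Lemma flip_disjoint x A B : [disjoint A & B]%B ->
  flip (flip x A) B = flip x (A :|: B).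
Proof.
move=> AB; apply/ffunP => k; rewrite !ffunE inE -addbA; congr (_ (+) _).
have := disjointFr AB (x := k).
by case: (k \in A) => // -> .
Qed.

Lemma card_diff_triangle x y w :
  (#|diff_set x w| <= #|diff_set x y| + #|diff_set y w|)%N.
Proof.
apply: leq_trans (leq_card_setU _ _); apply/subset_leq_card/subsetP => k.
by rewrite !inE; case: (x k) (y k) (w k) => [] [] [].
Qed.

Lemma cube_relE x y : cube_rel x y = (#|diff_set x y| == 1)%N.
Proof. by congr (_ == _); apply: eq_card => k; rewrite !inE. Qed.

Lemma cube_relP x y : reflect (exists i, y = flip x [set i]) (cube_rel x y).
Proof.
rewrite cube_relE; apply: (iffP cards1P) => -[i xy]; exists i.
  by rewrite -xy flip_diff.
by rewrite xy diff_flip.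
Qed.

Lemma cube_rel_flip x i : cube_rel x (flip x [set i]).
Proof. by apply/cube_relP; exists i. Qed.

Lemma dist_le_cube r x y : dist_le (@cube_rel n) r x y = (#|diff_set x y| <= r)%N.
Proof.
apply/dist_leP/idP => [[s [rs xs <-]]|].
  apply: leq_trans rs; elim: s x xs => [|z s IH] x /=.
    by rewrite leqn0 cards_eq0 -[X in diff_set _ X]flip_set0 diff_flip.
  rewrite cube_relE => /andP[/eqP xz /IH zs].
  by apply: leq_trans (card_diff_triangle x z _) _; rewrite xz.
rewrite -{2}(flip_diff x y); move: (diff_set x y) => A.
elim: r x A => [|r IH] x A.
  rewrite leqn0 cards_eq0 => /eqP ->.
  by exists [::]; rewrite flip_set0.
have [->|[i iA] Ar] := set_0Vmem A.
  by exists [::]; rewrite flip_set0.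
have [|s [rs xs sA]] := IH (flip x [set i]) (A :\ i).
  by rewrite (cardsD1 i) iA in Ar.
exists (flip x [set i] :: s); split => //=; first by rewrite cube_rel_flip.
rewrite sA flip_disjoint ?setD1K //.
by rewrite disjoint_sym disjoints_subset; apply/subsetP => k; rewrite !inE => /andP[].
Qed.

Lemma dist_le_flip r x A : (#|A| <= r)%N -> dist_le (@cube_rel n) r x (flip x A).
Proof. by rewrite dist_le_cube diff_flip. Qed.

(** If [v] and [w] differed, at least 3 coordinates would remain where they agree; flipping three of
    them at [w] stays within distance 3 of [w] but adds 3 to the distance from [v]. *)
Lemma ball3_center v w : (6 <= n)%N -> dist_le (@cube_rel n) 3 w v ->
  (forall y, dist_le (@cube_rel n) 3 w y -> dist_le (@cube_rel n) 3 v y) -> v = w.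
Proof.
move=> n6; rewrite dist_le_cube => D3 vw; apply/eqP/negPn/negP => vNw.
pose D := diff_set w v.
have D0 : (0 < #|D|)%N.
  rewrite card_gt0; apply: contra vNw => /eqP D0.
  by rewrite -(flip_diff w v) -/D D0 flip_set0.
have : (3 <= #|~: D|)%N by have := cardsC D; rewrite card_ord -/D in D3 *; lia.
case/card_geqP => s [us ss sD].
pose S := [set i in s].
have cS : #|S| = 3%N by rewrite cardsE; have/card_uniqP := us => ->.
have DS : [disjoint D & S]%B.
  rewrite disjoint_sym disjoints_subset; apply/subsetP => k; rewrite inE; exact: sD.
have := vw (flip w S) (dist_le_flip _ _); rewrite cS => /(_ isT).
rewrite dist_le_cube.
have -> : diff_set v (flip w S) = D :|: S.
  apply/setP => k; have := disjointFr DS (x := k); rewrite !inE ffunE /S inE.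
  by case: (v k) (w k) (k \in s) => [] [] [] // ->.
by rewrite cardsU (disjoint_setI0 DS) cards0 cS; lia.
Qed.

Lemma flip2 x i j : i != j -> flip (flip x [set i]) [set j] = flip x [set i; j].
Proof. by move=> ij; rewrite flip_disjoint // disjoints1 inE. Qed.

(** Two neighbours of [x] have only one common neighbour besides [x]. This determines an isomorphism
    on the second layer from its values on the first. *)
Lemma flip2_common x a b k l : a != b -> flip (flip x [set a]) [set k] != x ->
  flip (flip x [set a]) [set k] = flip (flip x [set b]) [set l] ->
  flip (flip x [set a]) [set k] = flip x [set a; b].
Proof.
move=> ab; have [->|ak yx] := eqVneq k a.
  case/eqP; apply/ffunP => i; rewrite !ffunE; by case: (i \in _); case: (x i).
suff kb : flip (flip x [set a]) [set k] = flip (flip x [set b]) [set l] -> k = b.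
  by move=> /kb ->; rewrite flip2.
(* Coordinate [a] forces [l = a]; coordinate [b] then forces [k = b]. *)
move=> /ffunP E; apply/eqP; have := E a; have := E b; rewrite !ffunE !inE.
rewrite !eqxx (negPf ab) (eq_sym b a) (negPf ab) (eq_sym a k) (negPf ak).
rewrite (eq_sym b k); case: (k == b) => //.
have [<-|] := eqVneq b l; rewrite ?(negPf ab); by case: (x a) (x b) => [] [].
Qed.

(* [flip v A] with [#|A| = 2] ranges over the vertices at distance 2 from [v]. *)
Definition layer_match (c l : cube n -> bool) v w (s : {ffun 'I_n -> 'I_n}) :=
  [forall A : {set 'I_n}, (#|A| == 2)%N ==> (c (flip v A) == l (flip w (s @: A)))].

Definition distinct_layers c := forall v w (s : {ffun 'I_n -> 'I_n}),
  v != w -> injective s -> ~~ layer_match c c v w s.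

Lemma layer_matchP c l v w (s : {ffun 'I_n -> 'I_n}) :
  reflect (forall A, #|A| = 2%N -> c (flip v A) = l (flip w (s @: A)))
          (layer_match c l v w s).
Proof.
apply: (iffP forallP) => H A.
  by move=> A2; have := H A; rewrite A2 => /eqP.
by apply/implyP => /eqP /H ->.
Qed.

(** The witness is [s] followed by the inverse of [t]. Two matches with the same layer of the
    unknown colouring [l] thus become a match that does not involve [l]. *)
Lemma layer_match_compV c c' l v v' w (s t : {ffun 'I_n -> 'I_n}) : injective s -> injective t ->
    layer_match c l v w s -> layer_match c' l v' w t ->
  exists2 u : {ffun 'I_n -> 'I_n}, injective u & layer_match c c' v v' u.
Proof.
move=> sI tI /layer_matchP vw /layer_matchP v'w.
pose u := [ffun i => invF tI (s i)].
exists u; first by move=> i j; rewrite !ffunE => /(can_inj (f_invF tI)) /sI.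
apply/layer_matchP => A A2; rewrite vw // v'w.
  congr (l (flip w _)); rewrite -imset_comp; apply: eq_imset => i /=.
  by rewrite ffunE f_invF.
rewrite card_imset // => i j; rewrite !ffunE => /(can_inj (f_invF tI)); exact: sI.
Qed.

Lemma exists_small_subset k (D : {set 'I_n}) :
  exists2 E : {set 'I_n}, (#|E| <= k)%N & ((#|D| <= k)%N -> E = D).
Proof.
have [Dk|kD] := leqP #|D| k; first by exists D.
by exists set0; rewrite ?cards0 // leqNgt kD.
Qed.

(** A common vertex makes [B] the symmetric difference of [D] and [A], so [D] has at most 4
    elements. If [A] also avoids [D], counting gives [D] empty, against [v != w]. *)
Lemma disjoint_layers v w : v != w ->
  exists2 E : {set 'I_n}, (#|E| <= 4)%N & forall A B : {set 'I_n},
    A \subset ~: E -> #|A| = 2%N -> #|B| = 2%N -> flip v A != flip w B.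
Proof.
move=> vw; pose D := diff_set v w.
(* If [D] has more than 4 elements the two 2-balls are disjoint, and no condition on
   [A] is needed. *)
have [E E4 ED] := exists_small_subset 4 D; exists E => // A B AE A2 B2.
apply/eqP => vAwB.
have inB k : (k \in B) = (k \in D) (+) (k \in A).
  move: vAwB => /ffunP/(_ k); rewrite !ffunE !inE.
  by case: (v k) (w k) (k \in A) (k \in B) => [] [] [] [].
have D4 : (#|D| <= 4)%N.
  have : (#|A :|: B| <= 4)%N by rewrite -[4%N]/(2 + 2)%N -{1}A2 -B2 leq_card_setU.
  apply: leq_trans; apply/subset_leq_card/subsetP => k.
  by rewrite !inE inB inE; case: (_ != _) (k \in A) => [] [].
have BE : B = D :|: A.
  apply/setP => k; rewrite inB in_setU -(ED D4).
  have := subsetP AE k; rewrite inE.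
  by case: (k \in E) (k \in A) => [] [] // /(_ isT).
have DA : D :&: A = set0.
  apply/setP => k; rewrite in_setI in_set0 -(ED D4).
  have := subsetP AE k; rewrite inE.
  by case: (k \in E) (k \in A) => [] [] // /(_ isT).
have : #|B| = (#|D| + 2)%N by rewrite BE cardsU DA cards0 subn0 A2.
rewrite B2 => D0; have {}D0 : D = set0 by apply/eqP; rewrite -cards_eq0; lia.
by move: vw; rewrite -(flip_diff v w) -/D D0 flip_set0 eqxx.
Qed.

(** * Isomorphisms of 3-balls and reconstruction of the colouring *)

Section Ball.
Variables (v : cube n) (F : cube n -> cube n) (c l : cube n -> bool).
Hypothesis FI : {in dist_le (@cube_rel n) 3 v &, injective F}.
Hypothesis Fe : {in dist_le (@cube_rel n) 3 v &, {mono F : x y / cube_rel x y}}.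
Hypothesis Fc : {in dist_le (@cube_rel n) 3 v, forall x, c x = l (F x)}.

(** The 2-ball around [u] lies in the 3-ball around [v]. Edges at [u] define [s], and the image of a
    vertex at distance 2 from [u] is the common neighbour, other than [F u], of two images of
    neighbours. *)
Lemma ball_layer_match u : dist_le (@cube_rel n) 1 v u ->
  exists s : {ffun 'I_n -> 'I_n},
    [/\ injective s, forall i, F (flip u [set i]) = flip (F u) [set s i] &
        layer_match c l u (F u) s].
Proof.
move=> uv.
have in3 A : (#|A| <= 2)%N -> flip u A \in dist_le (@cube_rel n) 3 v.
  move=> A2; rewrite [_ \in _]dist_le_cube.
  apply: leq_trans (card_diff_triangle _ u _) _; rewrite diff_flip.
  by move: uv; rewrite dist_le_cube; lia.
have in0 : u \in dist_le (@cube_rel n) 3 v.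
  by rewrite -[u]flip_set0 in3 // cards0.
have in1 i : flip u [set i] \in dist_le (@cube_rel n) 3 v by rewrite in3 // cards1.
have nb i : {j | F (flip u [set i]) == flip (F u) [set j]}.
  apply/sigW; have : cube_rel (F u) (F (flip u [set i])).
    by rewrite Fe // cube_rel_flip.
  by case/cube_relP => j ->; exists j.
pose s := [ffun i => sval (nb i)].
have sE i : F (flip u [set i]) = flip (F u) [set s i].
  by rewrite ffunE; exact/eqP/(svalP (nb i)).
have sI : injective s.
  move=> i j ij; have : F (flip u [set i]) = F (flip u [set j]) by rewrite !sE ij.
  by move=> /FI -/(_ (in1 i) (in1 j)) /flip_inj /set1_inj.
exists s; split => //; apply/layer_matchP => A /eqP/cards2P[i [j [ij ->]]].
have in2 : flip u [set i; j] \in dist_le (@cube_rel n) 3 v by rewrite in3 // cards2 ij.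
rewrite Fc //; congr (l _); rewrite imsetU !imset_set1.
have /cube_relP[k Ek] : cube_rel (F (flip u [set i])) (F (flip u [set i; j])).
  by rewrite Fe // -flip2 // cube_rel_flip.
have /cube_relP[k' Ek'] : cube_rel (F (flip u [set j])) (F (flip u [set i; j])).
  by rewrite Fe // setUC -flip2 1?eq_sym // cube_rel_flip.
rewrite sE in Ek; rewrite sE in Ek'.
rewrite Ek; apply: (@flip2_common _ _ _ _ k'); rewrite -?Ek -?Ek' ?(inj_eq sI) //.
apply/eqP => /FI; rewrite -[X in _ = X]flip_set0 => /(_ in2 in0) /flip_inj /setP /(_ i).
by rewrite !inE eqxx.
Qed.

End Ball.

(* The neighbour [w] of [v] is mapped to the same vertex by the isomorphism of the
   ball around [v] and by [f]: otherwise [w] and another vertex would have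
   matching layers. *)
Lemma distinct_layers_distinguishable (c : cube n -> bool) :
  (6 <= n)%N -> distinct_layers c -> distinguishable (@cube_rel n) 3 c.
Proof.
move=> n6 sep [l [[f [[g fK gK] fE]] []]].
have {fE}Fv v : exists F, [/\ F v = f v, {in dist_le (@cube_rel n) 3 v &, injective F},
     {in dist_le (@cube_rel n) 3 v &, {mono F : x y / cube_rel x y}} &
     {in dist_le (@cube_rel n) 3 v, forall x, c x = l (F x)}].
  have [F [FI Fe Fs Fr Fc]] := col_equiv_ball (fE v); exists F; split => //.
  (* The image of the ball around [v] is the whole ball around [f v], and all of it lies within
     distance 3 of [F v]. *)
  apply: ball3_center n6 _ _; first exact/Fr/dist_le_refl.
  move=> y /Fs[x xv <-]; apply: dist_le_homo xv => {}x y' xv yv.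
  by rewrite Fe.
have match_f v : exists2 s : {ffun 'I_n -> 'I_n}, injective s & layer_match c l v (f v) s.
  have [F [<- FI Fe Fc]] := Fv v.
  have [s [sI _ ms]] := ball_layer_match FI Fe Fc (dist_le_refl _ 1 v).
  by exists s.
have step v : exists2 s : {ffun 'I_n -> 'I_n}, injective s &
    forall i, f (flip v [set i]) = flip (f v) [set s i].
  have [F [<- FI Fe Fc]] := Fv v.
  have [s [sI sE _]] := ball_layer_match FI Fe Fc (dist_le_refl _ 1 v).
  exists s => // i; rewrite -sE; set w := flip v [set i].
  have [|t [tI _ mt]] := @ball_layer_match v F c l FI Fe Fc w.
    by apply: dist_le_flip; rewrite cards1.
  (* [g (F w)] is the vertex that [f] sends to [F w], so both it and [w] match the layer of [l] at
     [F w]. *)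
  have [t' t'I mt'] := match_f (g (F w)); rewrite gK in mt'.
  have [u uI mu] := layer_match_compV tI t'I mt mt'.
  have [{1}->|wNg] := eqVneq w (g (F w)); first by rewrite gK.
  by have := sep _ _ _ wNg uI; rewrite mu.
exists f; split; last first.
  by move=> v; have [F [<- _ _ ->//]] := Fv v; exact: dist_le_refl.
split=> [|v w]; first by exists g.
have [s sI sE] := step v.
apply/cube_relP/cube_relP => -[i].
  (* An injection of ['I_n] into itself is onto, so [f] reflects adjacency too. *)
  move=> fw; exists (invF sI i); apply: (can_inj fK).
  by rewrite sE f_invF.
by move=> ->; exists (s i); rewrite sE.
Qed.

End Flips.

(** * Probabilities of events about the random colouring *)

Lemma measure_le_sum (R : realType) (d : measure_display) (T : measurableType d)
    (P : probability T R) (I : finType) (F : I -> set T) (A : set T) :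
    measurable A -> (forall i, measurable (F i)) ->
    (forall w, A w -> exists i, F i w) -> (P A <= \sum_i P (F i))%E.
Proof.
move=> mA mF AF; rewrite fsbig_seq ?index_enum_uniq //.
apply: (@content_sub_fsum _ _ _ P) => //.
by move=> w /AF[i Fw]; exists i => //=; exact: mem_index_enum.
Qed.

Section Colouring.
Variables (R : realType) (d : measure_display) (T : measurableType d).
Variables (P : probability T R) (n : nat) (p : R).
Variable chi : cube n -> {RV P >-> bool}.
Hypothesis hchi : random_colouring p chi.

(** There are finitely many colourings, and the event of drawing a given one is a finite
    intersection of preimages. *)
Lemma measurable_colouring (Q : (cube n -> bool) -> Prop) :
  measurable [set w | Q (fun v => chi v w)].
Proof.
rewrite (_ : mkset _ = \bigcup_(c in [set c : {ffun cube n -> bool} | Q c])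
    \bigcap_(v in [set: cube n]) (chi v @^-1` [set c v])).
  apply: fin_bigcup_measurable => [|c _]; first exact: finite_finset.
  apply: fin_bigcap_measurable => [|v _]; first exact: finite_finset.
  exact: measurable_funPTI.
apply/seteqP; split=> [w /= Qw|w [c /= Qc wc] /=].
  exists [ffun v => chi v w] => /=; last by move=> v _; rewrite /= ffunE.
  by rewrite (_ : fun_of_fin _ = fun v => chi v w) //; apply/funext => v; rewrite ffunE.
by rewrite (_ : (fun v => _) = c) //; apply/funext => v; exact: wc.
Qed.

(** The pairs [(a k, b k)] are disjoint, hence independent, and each is monochromatic with
    probability [p ^+ 2 + (1 - p) ^+ 2]. The proof sums over the common colours [c] of the pairs. *)
Lemma coincidence_prob (K : finType) (a b : K -> cube n) :
    injective a -> injective b -> (forall i j, a i != b j) ->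
  (P [set w | forall k, chi (a k) w = chi (b k) w] <=
    ((p ^+ 2 + (1 - p) ^+ 2) ^+ #|K|)%:E)%E.
Proof.
move=> aI bI ab; case: hchi => ind Pf Pt.
pose h (x : K + K) := match x with inl k => a k | inr k => b k end.
have hI : injective h.
  by move=> [i|i] [j|j] /= E; rewrite ?(aI _ _ E) ?(bI _ _ E) //;
     have := ab i j; have := ab j i; rewrite E eqxx.
pose q (u : bool) := if u then 1 - p else p.
have Pq v u : P (chi v @^-1` [set u]) = (q u)%:E by case: u.
pose out (c : {ffun K -> bool}) (x : K + K) := match x with inl k => c k | inr k => c k end.
(* Independence wants events indexed by vertices, not by [K + K]; injectivity of [h] makes this a
   singleton at [h x]. *)
pose B c z := [set u | forall x, h x = z -> u = out c x].
have BE c x : B c (h x) = [set out c x].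
  by apply/seteqP; split=> u /= => [E|-> y /hI ->//]; exact: E.
pose A c := \bigcap_(z in [set` [set h x | x : K + K]%SET]) (chi z @^-1` B c z).
have mA c : measurable (A c).
  by apply: fin_bigcap_measurable => [|v _]; [exact: finite_finset|exact: measurable_funPTI].
apply: (@le_trans _ _ (\sum_(c : {ffun K -> bool}) P (A c))%E).
  apply: measure_le_sum => //; first by apply: (measurable_colouring
     (fun c => forall k, c (a k) = c (b k))).
  move=> w /= abw; exists [ffun k => chi (a k) w] => _ /imsetP[x _ ->] /= y /hI ->.
  by case: x => k /=; rewrite ffunE.
under eq_bigr => c _.
  rewrite /A ind; last by move=> i.
  rewrite big_imset /=; last by move=> x y _ _; exact: hI.
  under eq_bigr => x _ do rewrite BE Pq.
  rewrite prodEFin big_sumType /= -big_split /=.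
  over.
(* Distributivity turns the sum over all [c] into a product over [K] of sums over the two
   colours. *)
rewrite sumEFin -(bigA_distr_bigA (fun _ u => q u * q u)) /=.
rewrite prodr_const big_bool /= lee_fin.
by rewrite !expr2 addrC.
Qed.

Lemma layer_match_prob v w (s : {ffun 'I_n -> 'I_n}) :
    0 < p <= 1 / 2 -> v != w -> injective s ->
  (P [set x | layer_match (fun u => chi u x) (fun u => chi u x) v w s] <=
    ((1 - p) ^+ 'C(n - 4, 2))%:E)%E.
Proof.
move=> p12 vw sI.
have [E E4 vAwB] := disjoint_layers vw.
pose S := [set A : {set 'I_n} | A \subset ~: E & #|A| == 2]%SET.
have inS (A : {set 'I_n}) : A \in S -> (A \subset ~: E)%SET /\ #|A| = 2%N.
  by rewrite inE => /andP[? /eqP].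
have imsI (A B : {set 'I_n}) : s @: A = s @: B -> A = B by exact: imset_inj.
pose K : finType := {A : {set 'I_n} | A \in S}.
pose a (k : K) := flip v (val k); pose b (k : K) := flip w (s @: val k).
have aI : injective a by move=> i j /flip_inj /val_inj.
have bI : injective b by move=> i j /flip_inj /imsI /val_inj.
have ab i j : a i != b j.
  have [iE i2] := inS _ (valP i); have [_ j2] := inS _ (valP j).
  by apply: vAwB => //; rewrite card_imset.
apply: (@le_trans _ _ (P [set x | forall k, chi (a k) x = chi (b k) x])).
  apply: le_measure; rewrite ?inE.
  - exact: (measurable_colouring (fun c => layer_match c c v w s)).
  - exact: (measurable_colouring (fun c => forall k, c (a k) = c (b k))).
  - by move=> x /= /layer_matchP m k; apply: m; have [] := inS _ (valP k).
apply: le_trans (coincidence_prob aI bI ab) _; rewrite lee_fin.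
have cK : ('C(n - 4, 2) <= #|K|)%N.
  rewrite card_sig (eq_card (B := S)) // cards_draws; apply: leq_bin2l.
  by rewrite [leqRHS]cardsCs finset.setCK card_ord; apply: leq_sub2l.
move: p12 => /andP[p0 p12].
(* Since [p <= 1 / 2], [p ^+ 2 <= p * (1 - p)], so the base is at most [1 - p]. *)
apply: (@le_trans _ _ ((1 - p) ^+ #|K|)).
  apply: lerXn2r; rewrite ?nnegrE; nra.
by apply: ler_wiXn2l => //; lra.
Qed.

Lemma distinct_layers_prob : 0 < p <= 1 / 2 ->
  (1 - ((4 * n%:R) ^+ n * (1 - p) ^+ 'C(n - 4, 2))%:E <=
   P [set x | distinct_layers (fun v => chi v x)])%E.
Proof.
move=> p12; pose I : finType := (cube n * cube n * {ffun 'I_n -> 'I_n})%type.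
(* With the side conditions inside the event, inadmissible triples give the empty set and the sum
   may run over all of [I]. *)
pose F (t : I) : set T := [set x | [/\ t.1.1 != t.1.2, injective t.2 &
  layer_match (fun u => chi u x) (fun u => chi u x) t.1.1 t.1.2 t.2]].
have mF t : measurable (F t).
  exact: (measurable_colouring (fun c => [/\ t.1.1 != t.1.2, injective t.2 &
    layer_match c c t.1.1 t.1.2 t.2])).
have mS := measurable_colouring (@distinct_layers n).
rewrite -[X in P X]setCK probability_setC; last exact: measurableC.
apply: leeB => //; set bnd := (1 - p) ^+ _.
apply: (@le_trans _ _ (\sum_(t : I) P (F t))%E).
  apply: measure_le_sum => //; first exact: measurableC.
  move=> x /= nS; apply: contrapT => nF; apply: nS => v w s vw sI.
  by apply/negP => m; apply: nF; exists (v, w, s).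
apply: (@le_trans _ _ (\sum_(t : I) bnd%:E)%E).
  apply: lee_sum => -[[v w] s] _.
  have [[vw sI]|nvw] := pselect (v != w /\ injective s).
    apply: le_trans (layer_match_prob p12 vw sI).
    apply: le_measure; rewrite ?inE //; last by move=> x [].
    exact: (measurable_colouring (fun c => layer_match c c v w s)).
  rewrite (_ : F _ = set0) ?measure0 ?lee_fin; last first.
    by apply/seteqP; split=> // x [? ? _]; apply: nvw.
  by apply: exprn_ge0; move: p12 => /andP[_ p12]; lra.
rewrite sumEFin lee_fin sumr_const -[leLHS]mulr_natl ler_wpM2r //.
  by apply: exprn_ge0; move: p12 => /andP[_ p12]; lra.
have -> : #|I| = ((4 * n) ^ n)%N.
  by rewrite !card_prod !card_ffun card_bool !card_ord -!expnMn.
by rewrite natrX natrM.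
Qed.

End Colouring.

(** * Asymptotics and conclusion *)

(** With [L = ln n], the factors are at most [exp(2 n L)] and [exp(- p m)]. As [m >= n^2 / 8], the
    constant 24 gives [p m >= 3 n L], so the product is at most [n^(-n)]. *)
Lemma union_bound_small (R : realType) (n : nat) (p : R) :
    (20 <= n)%N -> 0 < p <= 1 / 2 -> 24 * ln n%:R <= n%:R * p ->
  (4 * n%:R) ^+ n * (1 - p) ^+ 'C(n - 4, 2) <= n.+1%:R^-1.
Proof.
move=> n20 /andP[p0 p12] npL; set m := 'C(n - 4, 2); set L := ln _ in npL.
have mn : n%:R ^+ 2 <= 8 * m%:R :> R.
  rewrite -natrX -natrM ler_nat /m.
  by have := mul_bin_diag (n - 4) 1; rewrite bin1; nia.
have n0 : 0 < n%:R :> R by rewrite ltr0n; lia.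
have expL : expR L = n%:R by rewrite lnK.
have n4 : 4 * n%:R <= expR (2 * L).
  by rewrite (expRM_natl 2) expL -natrX -natrM ler_nat; nia.
have q0 : 0 <= 1 - p by lra.
have qp : 1 - p <= expR (- p) by exact: expR_ge1Dx.
apply: (@le_trans _ _ (expR (2 * L) ^+ n * expR (- p) ^+ m)).
  by apply: ler_pM; rewrite ?exprn_ge0 ?lerXn2r ?nnegrE ?expR_ge0 // mulr_ge0 // ltW.
rewrite -!expRM_natl -expRD.
apply: (@le_trans _ _ (expR (- (n%:R * L)))).
  by rewrite ler_expR; nra.
rewrite expRN expRM_natl expL lef_pV2 ?posrE ?exprn_gt0 ?ltr0Sn //.
rewrite -natrX ler_nat; apply: (@leq_trans (n ^ 2)); first by nia.
by rewrite leq_pexp2l; lia.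
Qed.

Theorem theorem1p5 (R : realType) (p : nat -> R)
    (hp : forall n, 0 < p n <= 1 / 2)
    (hlim : (n%:R * p n / ln (n%:R : R)) @[n --> \oo] --> +oo)
    (d : nat -> measure_display) (T : forall n, measurableType (d n))
    (P : forall n, probability (T n) R)
    (chi : forall n, cube n -> {RV (P n) >-> bool})
    (hchi : forall n, random_colouring (p n) (chi n)) :
  P n [set w | distinguishable (@cube_rel n) 3 (fun v => chi n v w)]
    @[n --> \oo] --> 1%E.
Proof.
(* The lower bound holds once [n >= 20] and the ratio in [hlim] is at least 24. *)
apply: (@squeeze_cvge _ _ _ _ (fun n => (1 - n.+1%:R^-1)%:E) _ (fun=> 1%E)).
- near=> n.
  have n20 : (20 <= n)%N by near: n; exact: nbhs_infty_ge.
  have mD := measurable_colouring (chi n) (distinguishable (@cube_rel n) 3).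
  rewrite probability_le1 // andbT.
  apply: (@le_trans _ _ (P n [set w | distinct_layers (fun v => chi n v w)])).
    apply: le_trans (distinct_layers_prob (hchi n) (hp n)).
    rewrite lee_fin lerD2l lerN2; apply: union_bound_small => //.
    rewrite -ler_pdivlMr; last by rewrite ln_gt0 // ltr1n; lia.
    by near: n; exact: (cvgryPge _).1 hlim 24.
  apply: le_measure; rewrite ?inE //.
    exact: measurable_colouring (@distinct_layers n).
  by move=> w /=; apply: distinct_layers_distinguishable; lia.
- apply: cvg_EFin; first exact: nearW.
  by rewrite -[X in _ --> X]subr0; apply: cvgB; [exact: cvg_cst|exact: cvg_harmonic].
- exact: cvg_cst.
Unshelve. all: by end_near.
Qed.
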